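(* For all ternary signed-digit encodings $\alpha,\beta:\mathbb{N}\to\{\bar1,0,1\}$, we have $\langle\!\langle\mathrm{mid}(\alpha,\beta)\rangle\!\rangle=\langle\!\langle\alpha\rangle\!\rangle\oplus\langle\!\langle\beta\rangle\!\rangle$ in the interval object $\mathbb{I}$.
   Context: Work in constructive type theory with function extensionality. An interval object is a set $\mathbb{I}$ with binary $\oplus$, $M:\mathbb{I}^{\mathbb{N}}\to\mathbb{I}$, points $-1,+1$, such that $\oplus$ is idempotent, commutative, transpositional ($(a\oplus b)\oplus(c\oplus d)=(a\oplus c)\oplus(b\oplus d)$) and cancellative; $M(\alpha)=\alpha_0\oplus M(\mathrm{tail}\,\alpha)$; if $\beta_i=\alpha_i\oplus\beta_{i+1}$ for all $i$ then $\beta_0=M(\alpha)$; and for every set $B$ with $\oplus_B,M_B,s,t$ satisfying these conditions there is a unique $h:\mathbb{I}\to B$ with $h(-1)=s$, $h(+1)=t$, $h(a\oplus b)=h(a)\oplus_B h(b)$. Fix one; $0:=-1\oplus+1$. Ternary digits $\{\bar1,0,1\}$ denote $-1,0,1$; $\langle\bar1\rangle=-1,\langle0\rangle=0,\langle1\rangle=+1$; $\langle\!\langle\alpha\rangle\!\rangle:=M(n\mapsto\langle\alpha_n\rangle)$. Quinary digits are $\{-2,-1,0,1,2\}$; $\mathrm{add3}(a,b)$ is the integer sum of two ternary digits. Define $d:\{-2,\dots,2\}^2\to\{\bar1,0,1\}\times\{-2,\dots,2\}$ by $d(-2,y)=(\bar1,y)$, $d(0,y)=(0,y)$, $d(2,y)=(1,y)$,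 $d(-1,-2)=(\bar1,0)$, $d(-1,-1)=(\bar1,1)$, $d(-1,0)=(0,-2)$, $d(-1,1)=(0,-1)$, $d(-1,2)=(0,0)$, $d(1,-2)=(0,0)$, $d(1,-1)=(0,1)$, $d(1,0)=(0,2)$, $d(1,1)=(1,-1)$, $d(1,2)=(1,0)$. For $\gamma:\mathbb{N}\to\{-2,\dots,2\}$, define $\mathrm{div2}(\gamma)$ by recursion on the index: $\mathrm{div2}(\gamma)_0:=\pi_1 d(\gamma_0,\gamma_1)$ and $\mathrm{div2}(\gamma)_{n+1}:=\mathrm{div2}(\pi_2 d(\gamma_0,\gamma_1)::\mathrm{tail}(\mathrm{tail}\,\gamma))_n$ (where $x::\gamma$ prepends $x$). Finally $\mathrm{mid}(\alpha,\beta):=\mathrm{div2}(n\mapsto\mathrm{add3}(\alpha_n,\beta_n))$. *)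

(* Defs.v *)
From Stdlib Require Import ZArith.
From Stdlib.Logic Require Export FunctionalExtensionality HLevels.

Set Implicit Arguments.

Definition cons_seq {A : Type} (x : A) (s : nat -> A) : nat -> A :=
  fun n => match n with O => x | S k => s k end.

Definition tail_seq {A : Type} (s : nat -> A) : nat -> A := fun n => s (S n).

(* Cancellative midpoint algebras with infinitary iteration; [iter] is the
   operation M : A^N -> A. *)
Record convex_body : Type := ConvexBody {
  carrier :> Type;
  carrier_set : IsHSet carrier;
  mp : carrier -> carrier -> carrier;
  iter : (nat -> carrier) -> carrier;
  mp_idem : forall a, mp a a = a;
  mp_comm : forall a b, mp a b = mp b a;
  mp_transp : forall a b c d, mp (mp a b) (mp c d) = mp (mp a c) (mp b d);
  mp_cancel : forall a b c, mp a c = mp b c -> a = b;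
  iter_unfold : forall s, iter s = mp (s 0) (iter (tail_seq s));
  iter_unique : forall s t : nat -> carrier,
    (forall i, t i = mp (s i) (t (S i))) -> t 0 = iter s }.

Arguments mp {_} _ _.
Arguments iter {_} _.

Declare Scope interval_scope.
Notation "a ⊕ b" := (mp a b) (at level 50, left associativity) : interval_scope.
Open Scope interval_scope.

(* Maps are only required to preserve the end points and the binary midpoint,
   not [iter]. *)
Record interval_object : Type := IntervalObject {
  body :> convex_body;
  left_end : body;
  right_end : body;
  initiality : forall (B : convex_body) (s t : B),
    exists! h : body -> B,
      h left_end = s /\ h right_end = t /\
      (forall a b : body, h (a ⊕ b) = h a ⊕ h b) }.

Inductive ternary : Set := Tm1 | T0 | Tp1.

Inductive quinary : Set := Qm2 | Qm1 | Q0 | Qp1 | Qp2.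

Definition digit_val (I : interval_object) (x : ternary) : I :=
  match x with
  | Tm1 => left_end I
  | T0  => left_end I ⊕ right_end I
  | Tp1 => right_end I
  end.

Definition seq_val (I : interval_object) (alpha : nat -> ternary) : I :=
  iter (fun n => digit_val I (alpha n)).

Definition add3 (a b : ternary) : quinary :=
  match a, b with
  | Tm1, Tm1 => Qm2
  | Tm1, T0  => Qm1
  | Tm1, Tp1 => Q0
  | T0 , Tm1 => Qm1
  | T0 , T0  => Q0
  | T0 , Tp1 => Qp1
  | Tp1, Tm1 => Q0
  | Tp1, T0  => Qp1
  | Tp1, Tp1 => Qp2
  end.

Definition ternary_to_Z (x : ternary) : Z :=
  match x with Tm1 => -1 | T0 => 0 | Tp1 => 1 end%Z.

Definition quinary_to_Z (x : quinary) : Z :=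
  match x with Qm2 => -2 | Qm1 => -1 | Q0 => 0 | Qp1 => 1 | Qp2 => 2 end%Z.

Lemma add3_correct (a b : ternary) :
  quinary_to_Z (add3 a b) = (ternary_to_Z a + ternary_to_Z b)%Z.
Proof. destruct a, b; reflexivity. Qed.

Definition div2_step (x y : quinary) : ternary * quinary :=
  match x, y with
  | Qm2, y   => (Tm1, y)
  | Qm1, Qm2 => (Tm1, Q0)
  | Qm1, Qm1 => (Tm1, Qp1)
  | Qm1, Q0  => (T0 , Qm2)
  | Qm1, Qp1 => (T0 , Qm1)
  | Qm1, Qp2 => (T0 , Q0)
  | Q0 , y   => (T0 , y)
  | Qp1, Qm2 => (T0 , Q0)
  | Qp1, Qm1 => (T0 , Qp1)
  | Qp1, Q0  => (T0 , Qp2)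
  | Qp1, Qp1 => (Tp1, Qm1)
  | Qp1, Qp2 => (Tp1, Q0)
  | Qp2, y   => (Tp1, y)
  end.

Fixpoint div2 (gamma : nat -> quinary) (n : nat) {struct n} : ternary :=
  match n with
  | O => fst (div2_step (gamma 0) (gamma 1))
  | S k =>
      div2 (cons_seq (snd (div2_step (gamma 0) (gamma 1)))
                     (tail_seq (tail_seq gamma))) k
  end.

Definition mid (alpha beta : nat -> ternary) : nat -> ternary :=
  div2 (fun n => add3 (alpha n) (beta n)).

(* Main.v *)
Require Import Defs.

(** Read a quinary digit [x] as the point [x / 2] of the interval.  Iteration
    commutes with the pointwise midpoint, so the right-hand side is the value
    of the quinary sequence [fun n => add3 (alpha n) (beta n)].  One step of [div2] preserves
    this value, because [div2_step x y = (a, b)] implies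
    [x ⊕ (y ⊕ z) = a ⊕ (b ⊕ z)] for every [z]; the uniqueness property of
    [iter] then identifies the value of [div2 gamma] with that of [gamma]. *)

Set Implicit Arguments.

(** By transposition, the midpoints of the values of the shifted sequences satisfy the recursion
    required by [iter_unique]. *)
Lemma iter_mp (A : convex_body) (s t : nat -> A) :
  iter s ⊕ iter t = iter (fun n => s n ⊕ t n).
Proof.
  apply (iter_unique A _
           (fun i => iter (fun n => s (i + n)) ⊕ iter (fun n => t (i + n)))).
  assert (unfold : forall (u : nat -> A) i,
    iter (fun n => u (i + n)) = u i ⊕ iter (fun n => u (S i + n))).
  { intros u i. rewrite iter_unfold. unfold tail_seq. f_equal.
    - now rewrite <- plus_n_O.
    - f_equal. extensionality n. now rewrite <- plus_n_Sm. }
  intro i. rewrite (unfold s), (unfold t). apply mp_transp.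
Qed.

(* Both sides of the goal have the same midpoint with [a ⊕ (b ⊕ w)]. *)
Lemma mp_mp_change_last (A : convex_body) (a b a' b' w z : A) :
  a ⊕ (b ⊕ w) = a' ⊕ (b' ⊕ w) -> a ⊕ (b ⊕ z) = a' ⊕ (b' ⊕ z).
Proof.
  intro E. apply (mp_cancel A) with (c := a ⊕ (b ⊕ w)).
  rewrite E at 1.
  rewrite (mp_transp A a' _ a), (mp_transp A b' _ b), (mp_comm A a' a),
    (mp_comm A b' b), (mp_transp A b b'), <- (mp_transp A a).
  reflexivity.
Qed.

Definition quinary_val (I : interval_object) (x : quinary) : I :=
  let zero := left_end I ⊕ right_end I in
  match x with
  | Qm2 => left_end I
  | Qm1 => left_end I ⊕ zero
  | Q0 => zero
  | Qp1 => right_end I ⊕ zero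
  | Qp2 => right_end I
  end.

Lemma quinary_val_add3 (I : interval_object) (a b : ternary) :
  quinary_val I (add3 a b) = digit_val I a ⊕ digit_val I b.
Proof.
  destruct a, b; simpl; rewrite ?mp_idem; trivial; apply mp_comm.
Qed.

Lemma half_add_neg_half (I : interval_object) :
  quinary_val I Qp1 ⊕ quinary_val I Qm1 = quinary_val I Q0.
Proof.
  simpl. rewrite mp_transp, mp_idem, (mp_comm I (right_end I)). apply mp_idem.
Qed.

(** Read as integers, the output (a, b) of [div2_step x y] satisfies 2x + y = 4a + b. *)
Lemma div2_step_val (I : interval_object) (x y : quinary) (z : I) :
  quinary_val I x ⊕ (quinary_val I y ⊕ z) =
  digit_val I (fst (div2_step x y))
    ⊕ (quinary_val I (snd (div2_step x y)) ⊕ z).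
Proof.
  (* A last argument making [y ⊕ w] or [b ⊕ w] collapse. *)
  pose (w := match x, y with
             | Qm1, Qm2 | Qp1, Qp2 => Q0
             | Qm1, Qm1 | Qm1, Qp1 => Qm1
             | Qp1, Qm1 | Qp1, Qp1 => Qp1
             | Qm1, _ => Qm2
             | _, _ => Qp2
             end).
  apply mp_mp_change_last with (w := quinary_val I w).
  pose proof (half_add_neg_half I) as H.
  pose proof (mp_idem I) as idem. pose proof (mp_comm I) as comm.
  (* For odd [x], ground instances of idempotence and commutativity, together with [H], suffice. *)
  destruct x, y; try reflexivity; simpl in *;
    set (l := left_end I) in *; set (r := right_end I) in *;
    pose proof (comm l r); set (zero := l ⊕ r) in *;
    pose proof (comm zero l); pose proof (comm zero r);
    pose proof (comm (l ⊕ zero) (r ⊕ zero));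
    pose proof (comm zero (l ⊕ zero)); pose proof (comm zero (r ⊕ zero));
    pose proof (idem l); pose proof (idem r); pose proof (idem zero);
    pose proof (idem (l ⊕ zero)); pose proof (idem (r ⊕ zero));
    congruence.
Qed.

Definition div2_next (gamma : nat -> quinary) : nat -> quinary :=
  cons_seq (snd (div2_step (gamma 0) (gamma 1))) (tail_seq (tail_seq gamma)).

(** Trades recursion on the index for iteration on the sequence, so that every output digit is a
    first digit. *)
Lemma div2_iter_next (n : nat) (gamma : nat -> quinary) :
  div2 gamma n = div2 (Nat.iter n div2_next gamma) 0.
Proof.
  revert gamma; induction n as [|n IH]; intro gamma; [reflexivity|].
  now rewrite PeanoNat.Nat.iter_succ_r, <- IH.
Qed.

Lemma iter_div2_next (I : interval_object) (gamma : nat -> quinary) :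
  iter (fun n => quinary_val I (gamma n)) =
  digit_val I (div2 gamma 0)
    ⊕ iter (fun n => quinary_val I (div2_next gamma n)).
Proof.
  rewrite iter_unfold, (iter_unfold I (tail_seq _)).
  rewrite (iter_unfold I (fun n => quinary_val I (div2_next gamma n))).
  apply div2_step_val.
Qed.

Lemma seq_val_div2 (I : interval_object) (gamma : nat -> quinary) :
  seq_val I (div2 gamma) = iter (fun n => quinary_val I (gamma n)).
Proof.
  symmetry.
  (* The witness at [i] is the value of the quinary sequence left after [i] steps. *)
  apply (iter_unique I _ (fun i =>
    iter (fun n => quinary_val I (Nat.iter i div2_next gamma n)))).
  intro i. rewrite div2_iter_next. apply iter_div2_next.
Qed.

Theorem theorem5p67 (I : interval_object) (alpha beta : nat -> ternary) :
  seq_val I (mid alpha beta) = seq_val I alpha ⊕ seq_val I beta.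
Proof.
  unfold mid. rewrite seq_val_div2. unfold seq_val. rewrite iter_mp.
  f_equal. extensionality n. apply quinary_val_add3.
Qed.
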